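(* There is an arithmetic term $C(m,n,P,c_0,\mathrm{max},t)$ that simulates every goto program, in the following sense. (1) For every goto program with $m$ lines and registers $x_1,\dots,x_{n-1}$, with program code $P$, every start configuration $\iota_0=(1,x_1^{(0)},\dots,x_{n-1}^{(0)})$ and every $t\in\mathbb{N}$, put $\mathrm{max}=\max(\iota_0)$ (the maximum of all components of $\iota_0$), $B=m+\mathrm{max}+t$, and let $c_0$ be the code of $\iota_0$ in base $B$. Then $C(m,n,P,c_0,\mathrm{max},t)$ is the code in base $B$ of the configuration reached after $t$ steps. (2) Consequently, let $1\le r\le n-1$ and let $f:\mathbb{N}^r\to\mathbb{N}$ be computed by such a program (with arguments initially in $x_1,\dots,x_r$, all other registers $0$, and the result read in $x_1$ after the program stops), and let its computation time on $(x_1,\dots,x_r)$ be bounded by $\theta(x_1,\dots,x_r)$, where $\theta$ is an arithmetic term. Writing $\theta=\theta(x_1,\dots,x_r)$, $\mu=\max(1,x_1,\dots,x_r)$, $B=m+\mu+\theta$ and $c_0=1+x_1B+\dots+x_rB^r$, one has the arithmetic term representation $$f(x_1,\dots,x_r)=\left\lfloor\frac{C(m,n,P,c_0,\mu,\theta)\bmod B^2}{B}\right\rfloor .$$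
   Context: $\mathbb{N}=\{0,1,2,\dots\}$. An arithmetic term is a finite expression built from variables ranging over $\mathbb{N}$ and natural-number constants by composing addition $x+y$, truncated subtraction $x \dot{-} y=\max(x-y,0)$, multiplication, $\lfloor x/y\rfloor$, $x \bmod y$, and exponentiation $x^y$ (conventions: $x \bmod 0 = x$; for definiteness $\lfloor x/0\rfloor=0$, $0^0=1$). Goto programs: a program has $m$ lines labeled $1,\dots,m$ and registers $x_1,\dots,x_{n-1}$ containing natural numbers. Each line is represented by a tuple $(i,j,s,u,L_1,L_2)$ of one of the following kinds, where register indices lie in $\{1,\dots,n-1\}$ and labels in $\{1,\dots,m\}$: copy command $(i,j,s,0,0,0)$ with $i,j\neq0$, $s\in\{0,1,2\}$, meaning $x_i:=(x_j+s)\dot{-}1$ and then proceed to the next line; goto command $(0,0,0,u,L_1,L_2)$ with $u\ne0$, meaning: if $x_u=0$ go to line $L_1$, else go to line $L_2$; stop command $(0,0,0,0,0,0)$, which leaves the configuration unchanged. Labels reached during execution always lie in $\{1,\dots,m\}$. A configuration is $\iota=(L,x_1,\dots,x_{n-1})$, where $L$ is the label of the line to be performed next; its code in base $B$ is $L+x_1B+\dots+x_{n-1}B^{n-1}$. Program code: with $b=n+m+1$, the line $(i,j,s,u,L_1,L_2)$ is encoded by $i+jb+sb^2+ub^3+L_1b^4+L_2b^5$, and if $e_L$ is the code of the line with label $L$, then $P=\sum_{L=1}^{m}e_Lb^{6L}$. *)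

(* Defs.v *)
From mathcomp Require Import all_boot.

Set Implicit Arguments.
Unset Strict Implicit.
Unset Printing Implicit Defensive.

(** Arithmetic terms in [k] variables.  The operations of ssrnat and div already
    follow the conventions [x %% 0 = x], [x %/ 0 = 0] and [0 ^ 0 = 1]. *)

Inductive aterm (k : nat) : Type :=
| AVar of 'I_k
| AConst of nat
| AAdd of aterm k & aterm k
| ASub of aterm k & aterm k
| AMul of aterm k & aterm k
| ADiv of aterm k & aterm k
| AMod of aterm k & aterm k
| AExp of aterm k & aterm k.

Fixpoint aeval (k : nat) (T : aterm k) (v : k.-tuple nat) : nat :=
  match T with
  | AVar i => tnth v i
  | AConst c => c
  | AAdd T1 T2 => aeval T1 v + aeval T2 v
  | ASub T1 T2 => aeval T1 v - aeval T2 v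
  | AMul T1 T2 => aeval T1 v * aeval T2 v
  | ADiv T1 T2 => aeval T1 v %/ aeval T2 v
  | AMod T1 T2 => aeval T1 v %% aeval T2 v
  | AExp T1 T2 => aeval T1 v ^ aeval T2 v
  end.

(** Goto programs with [m] lines and [n.-1] registers.  Ordinals count from 0:
    [i : 'I_n.-1] stands for the register x_(i+1), and [L : 'I_m] for the label
    L+1. *)

Inductive command (m n : nat) : Type :=
| Copy (i j : 'I_n.-1) (s : 'I_3)
| Goto (u : 'I_n.-1) (L1 L2 : 'I_m)
| Stop.

Arguments Stop {m n}.

Definition program (m n : nat) : Type := m.-tuple (command m n).

(** Labels of configurations are the actual labels 1, ..., m.  They are kept in
    [nat] because a copy command in line m leads to the label m+1. *)

Record config (n : nat) : Type :=
  Config { label : nat; regs : (n.-1).-tuple nat }.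

(** The line with label [L]; meaningful for 1 <= L <= m only. *)
Definition line (m n : nat) (p : program m n) (L : nat) : command m n :=
  nth Stop p L.-1.

Definition step (m n : nat) (p : program m n) (c : config n) : config n :=
  match line p (label c) with
  | Copy i j s =>
      Config (label c).+1
        [tuple if k == i then tnth (regs c) j + s - 1 else tnth (regs c) k
        | k < n.-1]
  | Goto u L1 L2 =>
      Config (if tnth (regs c) u == 0 then L1.+1 else L2.+1) (regs c)
  | Stop => c
  end.

Definition run (m n : nat) (p : program m n) (t : nat) (c : config n) :
  config n := iter t (step p) c.

Definition labels_in_range (m n : nat) (p : program m n) (c : config n) : Prop :=
  forall t, 1 <= label (run p t c) <= m.

Definition stopped (m n : nat) (p : program m n) (c : config n) : bool :=
  if line p (label c) is Stop then true else false.

Definition start_config (n : nat) (x : (n.-1).-tuple nat) : config n :=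
  Config 1 x.

Definition config_max (n : nat) (c : config n) : nat :=
  \max_(v <- label c :: regs c) v.

Definition config_code (n B : nat) (c : config n) : nat :=
  label c + \sum_(i < n.-1) tnth (regs c) i * B ^ i.+1.

(** The tuple (i, j, s, u, L_1, L_2), read in base [b]. *)
Definition tuple_code (b i j s u L1 L2 : nat) : nat :=
  i + j * b + s * b ^ 2 + u * b ^ 3 + L1 * b ^ 4 + L2 * b ^ 5.

Definition command_code (m n b : nat) (e : command m n) : nat :=
  match e with
  | Copy i j s => tuple_code b i.+1 j.+1 s 0 0 0
  | Goto u L1 L2 => tuple_code b 0 0 0 u.+1 L1.+1 L2.+1
  | Stop => tuple_code b 0 0 0 0 0 0
  end.

Definition program_code (m n : nat) (p : program m n) : nat :=
  let b := n + m + 1 in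
  \sum_(L < m) command_code b (tnth p L) * b ^ (6 * L.+1).

(** Arguments in the first [r] registers, all other registers 0. *)
Definition input_config (n r : nat) (x : r.-tuple nat) : config n :=
  start_config [tuple nth 0 x k | k < n.-1].

Definition computes (m n r : nat) (p : program m n) (f : r.-tuple nat -> nat) :
  Prop :=
  forall x : r.-tuple nat,
    labels_in_range p (input_config n x) /\
    exists t, stopped p (run p t (input_config n x)) /\
              nth 0 (regs (run p t (input_config n x))) 0 = f x.

(** The number of steps performed before a stop command is reached. *)
Definition computation_time (m n : nat) (p : program m n) (c : config n)
  (t : nat) : Prop :=
  stopped p (run p t c) /\ forall t', t' < t -> ~~ stopped p (run p t' c).

(* Main.v *)
Require Import Defs.
From mathcomp Require Import all_boot zify ring.

Set Implicit Arguments.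
Unset Strict Implicit.
Unset Printing Implicit Defensive.

(** Arithmetic terms are closed under bounded sums, hence under bounded iteration
    of a step function, as a history of the iteration is a number whose digits
    satisfy a bounded condition and which a bounded sum can find.  The step of a
    goto program on codes of configurations is an arithmetic term.

    For closure under bounded sums, represent a function [f] on [0, N) by the
    polynomial [\sum_(x < N) f x * b ^ x].  Pointwise products of coefficients
    arise from products of polynomials by extracting one digit in a large base.
    Zeros of [f] are counted by the number of one bits of a suitable number, and
    the number of one bits of [n] is the 2-adic valuation of ['C(2 * n, n)],
    where binomials are digits of powers and gcds digits of products of geometric
    sums.
    Testing for zero gives comparison, division and exponentiation. *)

(** * Digits and polynomial values *)

Lemma div_mod_digit (e n lo mid hi : nat) :
  lo < e ^ n -> mid < e -> (lo + (mid + hi * e) * e ^ n) %/ e ^ n %% e = mid.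
Proof.
move=> lt_lo lt_mid; have e_gt0 : 0 < e ^ n by apply: leq_ltn_trans lt_lo.
by rewrite divnDMl // divn_small // add0n addnC modnMDl modn_small.
Qed.

Lemma sum_digit_lt (B k : nat) (d : nat -> nat) :
  (forall i, i < k -> d i < B) -> \sum_(i < k) d i * B ^ i < B ^ k.
Proof.
elim: k => [|k IHk] dB; first by rewrite big_ord0.
rewrite big_ord_recr /= expnS.
have dk : d k < B by exact: dB.
have := IHk (fun i lt_ik => dB i (ltnW lt_ik)).
move: (B ^ k) (\sum_(_ < _) _) => X S ltSX; nia.
Qed.

Lemma digit_sum (B k : nat) (d : nat -> nat) (j : nat) :
  (forall i, i < k -> d i < B) -> j < k ->
  (\sum_(i < k) d i * B ^ i) %/ B ^ j %% B = d j.
Proof.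
move=> dB lt_jk.
have [q ->] : exists q, \sum_(i < k) d i * B ^ i
    = \sum_(i < j) d i * B ^ i + (d j + q * B) * B ^ j.
  elim: k lt_jk {dB} => // k IHk; rewrite ltnS leq_eqVlt => /orP[/eqP <-|].
    by exists 0; rewrite big_ord_recr /= mul0n addn0.
  move=> lt_jk; have [q Eq] := IHk lt_jk.
  exists (q + d k * B ^ (k - j.+1)); rewrite big_ord_recr /= Eq.
  have -> : B ^ k = B ^ (k - j.+1) * (B * B ^ j).
    by rewrite -expnS -expnD subnK.
  by ring.
apply: div_mod_digit; last exact: dB.
by apply: sum_digit_lt => i lt_ij; apply/dB/ltn_trans/lt_jk.
Qed.

(** Terms of exponent below [n] add up to less than [e ^ n], since all coefficients together stay
    below [e]; terms of exponent above [n] are multiples of [e ^ n.+1]. Exponents may repeat. *)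
Lemma coef_sum (I : Type) (r : seq I) (a d : I -> nat) (e n : nat) :
  \sum_(i <- r) a i < e ->
  (\sum_(i <- r) a i * e ^ d i) %/ e ^ n %% e = \sum_(i <- r | d i == n) a i.
Proof.
move=> lt_ae; have e_gt0 : 0 < e by apply: leq_ltn_trans lt_ae.
have [lo [hi [-> le_lo le_mid]]] : exists lo hi,
    [/\ \sum_(i <- r) a i * e ^ d i
        = lo + (\sum_(i <- r | d i == n) a i + hi * e) * e ^ n,
        lo * e <= (\sum_(i <- r) a i) * e ^ n &
        \sum_(i <- r | d i == n) a i <= \sum_(i <- r) a i].
  elim: r {lt_ae} => [|i r [lo [hi [Er le_lo le_mid]]]].
    by exists 0, 0; rewrite !big_nil !mul0n.
  rewrite !big_cons Er; case: (ltngtP (d i) n) => [lt_dn | lt_nd | ->].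
  - exists (a i * e ^ d i + lo), hi; split; [by rewrite addnA | | lia].
    rewrite !mulnDl leq_add // -mulnA leq_mul2l -expnSr leq_pexp2l ?orbT //.
  - exists lo, (a i * e ^ (d i - n.+1) + hi); split; [| nia | lia].
    rewrite -{1}(subnK lt_nd) expnD expnS; move: (e ^ _) (e ^ n) => X Y.
    by move: (\sum_(_ <- _ | _) _) => Z; nia.
  - exists lo, hi; split; [| nia | lia].
    by move: (e ^ n) (\sum_(_ <- _ | _) _) => X Y; nia.
apply: div_mod_digit; last exact: leq_ltn_trans lt_ae.
have: 0 < e ^ n by rewrite expn_gt0 e_gt0.
by move: (e ^ n) le_lo lt_ae; move: (\sum_(_ <- r) _) => S X; nia.
Qed.

Lemma eq_modn_sum (I : Type) (r : seq I) (P : pred I) (F G : I -> nat) (d : nat) :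
  (forall i, P i -> F i = G i %[mod d]) ->
  \sum_(i <- r | P i) F i = \sum_(i <- r | P i) G i %[mod d].
Proof.
move=> eqFG; rewrite -modn_summ -[RHS]modn_summ.
by congr (_ %% _); apply: eq_bigr.
Qed.

(** Modulo [e ^ N - 1] the power [e ^ N] is 1, so exponents wrap around modulo [N]; the bound on the
    coefficients keeps the wrapped sum below the modulus. *)
Lemma sum_mod_predn_exp (I : Type) (r : seq I) (a d : I -> nat) (e N : nat) :
  0 < N -> \sum_(i <- r) a i + 1 < e ->
  (\sum_(i <- r) a i * e ^ d i) %% (e ^ N - 1)
  = \sum_(i <- r) a i * e ^ (d i %% N).
Proof.
move=> N_gt0 lt_ae.
have e_gt0 : 0 < e by apply: leq_ltn_trans lt_ae.
have X_gt0 : 0 < e ^ N.-1 by rewrite expn_gt0 e_gt0.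
have eN : e ^ N = e * e ^ N.-1 by rewrite -expnS prednK.
have e1 : e ^ N = 1 %[mod e ^ N - 1].
  have le1: 1 <= e ^ N by rewrite expn_gt0 e_gt0.
  by rewrite -{1}(subnK le1) modnDl.
rewrite -[RHS](@modn_small _ (e ^ N - 1)).
  apply: eq_modn_sum => i _; rewrite -[LHS]modnMmr -[RHS]modnMmr.
  congr (_ * _ %% _); rewrite {1}(divn_eq (d i) N) mulnC expnD expnM.
  by rewrite -modnMml -modnXm e1 modnXm exp1n modnMml mul1n.
apply: (@leq_ltn_trans ((\sum_(i <- r) a i) * e ^ N.-1)).
  rewrite big_distrl /=; apply: leq_sum => i _.
  rewrite leq_mul2l leq_pexp2l ?orbT //.
  by have := ltn_pmod (d i) N_gt0; lia.
rewrite eN; move: (\sum_(_ <- _) _) lt_ae => S lt_Se.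
have: (S + 2) * e ^ N.-1 <= e * e ^ N.-1 by rewrite leq_mul2r; lia.
by lia.
Qed.

Lemma sum_mod_change_base (N : nat) (f : nat -> nat) (e b : nat) :
  b <= e -> \sum_(x < N) f x * b ^ x < e - b ->
  (\sum_(x < N) f x * e ^ x) %% (e - b) = \sum_(x < N) f x * b ^ x.
Proof.
move=> le_be lt_Se; rewrite -[RHS](modn_small lt_Se).
apply: eq_modn_sum => x _; rewrite -[LHS]modnMmr -modnXm -{1}(subnK le_be) modnDl modnXm.
by rewrite modnMmr.
Qed.

(** The bijection of [z] with the pair [(z %% N, z %/ N)] flattens a double sum, so that packing
    over one index suffices. *)
Lemma sum_mod_div (N K : nat) (F : nat -> nat -> nat) :
  \sum_(z < N * K) F (z %% N) (z %/ N) = \sum_(x < N) \sum_(y < K) F x y.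
Proof.
case: N => [|N]; first by rewrite !big_ord0.
rewrite exchange_big /= mulnC; elim: K => [|K IHK]; first by rewrite !big_ord0.
rewrite [RHS]big_ord_recr -IHK /=.
rewrite -(big_mkord xpredT (fun z => F (z %% N.+1) (z %/ N.+1))).
rewrite mulSn addnC (@big_cat_nat _ _ _ (K * N.+1)) ?leq_addr //=.
rewrite big_mkord; congr (_ + _).
have shift G a : \sum_(a <= z < a + N.+1) G z = \sum_(x < N.+1) G (x + a).
  by rewrite -[X in \sum_(X <= _ < _) _]add0n big_addn addKn big_mkord.
rewrite shift; apply: eq_bigr => x _.
by rewrite addnC modnMDl divnMDl // modn_small // divn_small // addn0.
Qed.

Lemma sum_geom (M b : nat) : 1 < b ->
  (\sum_(x < M) b ^ x) * (b - 1) = b ^ M - 1.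
Proof. by move=> b1; rewrite !subn1 mulnC -predn_exp. Qed.

Lemma sum_id_geom (N b : nat) : 0 < b ->
  (\sum_(x < N) x * b ^ x) * (b - 1) + b * (\sum_(x < N) b ^ x) = N * b ^ N.
Proof.
move=> b_gt0; elim: N => [|N IHN]; first by rewrite !big_ord0 muln0.
rewrite !big_ord_recr /= mulnDl mulnDr addnACA IHN expnS.
by move: (b ^ N) => X; nia.
Qed.

(** * Counting one bits *)

(** The coefficients of [(e + 1) ^ (2 * n)] sum to [2 ^ (2 * n) < e], so each is a digit in base
    [e]. *)
Lemma central_binomial_coef (n : nat) :
  let e := 2 ^ (2 * n) + 1 in
  'C(2 * n, n) = ((e + 1) ^ (2 * n)) %/ e ^ n %% e.
Proof.
move=> e; have -> : (e + 1) ^ (2 * n) = \sum_(i < (2 * n).+1) 'C(2 * n, i) * e ^ i.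
  by rewrite addnC expnDn; apply: eq_bigr => i _; rewrite exp1n mul1n.
have lt_n : n < (2 * n).+1 by lia.
rewrite (@coef_sum _ _ (fun i : 'I__ => 'C(2 * n, i)) (fun i : 'I__ => i : nat)).
  by rewrite (big_pred1 (Ordinal lt_n)) // => i; rewrite -val_eqE.
have -> : \sum_(i < (2 * n).+1) 'C(2 * n, i) = 2 ^ (2 * n).
  by rewrite (expnDn 1 1); apply: eq_bigr => i _; rewrite !exp1n !muln1.
by rewrite /e addn1.
Qed.

(** With [g] the gcd, [b] divides [a * x] exactly when [b %/ g] divides [x], and [[0, b)] contains
    [g] multiples of [b %/ g]. *)
Lemma gcd_count (a b : nat) : 0 < b -> \sum_(x < b) (b %| a * x) = gcdn a b.
Proof.
move=> b_gt0; set g := gcdn a b; have g_gt0 : 0 < g by rewrite gcdn_gt0 b_gt0 orbT.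
have Eb : b = b %/ g * g by rewrite divnK ?dvdn_gcdr.
have Ea : a = a %/ g * g by rewrite divnK ?dvdn_gcdl.
have co_ba : coprime (b %/ g) (a %/ g).
  rewrite /coprime -(eqn_pmul2r g_gt0) muln_gcdl -Eb -Ea mul1n.
  by rewrite gcdnC.
have Edvd x : (b %| a * x) = (x %% (b %/ g) == 0).
  by rewrite {1}Eb {1}Ea mulnAC dvdn_pmul2r // Gauss_dvdr.
under eq_bigr => x _ do rewrite Edvd.
have -> : \sum_(x < b) (x %% (b %/ g) == 0)
        = \sum_(x < b %/ g * g) (x %% (b %/ g) == 0) by rewrite -Eb.
rewrite (sum_mod_div _ _ (fun x y => x == 0)).
have: 0 < b %/ g by rewrite divn_gt0 // dvdn_leq ?dvdn_gcdr.
case: (b %/ g) => // c _; rewrite big_ord_recl /= sum1_card card_ord.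
by rewrite big1 ?addn0 // => i _; rewrite big1.
Qed.

(* The coefficient of [e ^ (a * b)] counts the solutions of [a * x = b * y] with
   [x < b] and [y < a]; the second factor carries the exponents [b * (a - y)]. *)
Lemma gcd_coef (a b : nat) : 0 < a -> 0 < b ->
  let e := a * b + 1 in
  gcdn a b = (\sum_(x < b) (e ^ a) ^ x) * (e ^ b * \sum_(y < a) (e ^ b) ^ y)
             %/ e ^ (a * b) %% e.
Proof.
move=> a_gt0 b_gt0 e; rewrite big_distrr big_distrl /=.
under eq_bigr => x _ do rewrite big_distrr /=.
rewrite pair_bigA /=.
under eq_bigr => p _ do rewrite -!expnM -!expnD -[_ ^ _]mul1n.
rewrite coef_sum; last by rewrite sum1_card card_prod !card_ord /e; lia.
rewrite -(pair_big_dep xpredT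
  (fun (x : 'I_b) (y : 'I_a) => a * x + (b + b * y) == a * b) (fun _ _ => 1)) /=.
rewrite -gcd_count //; apply: eq_bigr => x _.
rewrite sum1_card; have [/dvdnP[q Eq] | ndvd] := boolP (b %| a * x).
  have lt_qa : q < a by have := ltn_ord x; nia.
  have lt_y : a.-1 - q < a by lia.
  rewrite (@eq_card1 _ (Ordinal lt_y)) // => y; rewrite !inE -val_eqE /= Eq.
  apply/eqP/eqP => [|->]; last by nia.
  by have := ltn_ord y; nia.
rewrite eq_card0 // => y; apply/negP => /eqP Exy.
case/negP: ndvd; apply/dvdnP; exists (a.-1 - y).
by have := ltn_ord y; nia.
Qed.

Lemma logn2_fact_double n : logn 2 (2 * n)`! = n + logn 2 n`!.
Proof.
elim: n => // n IHn; have -> : 2 * n.+1 = (2 * n).+2 by lia.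
rewrite !factS !lognM ?fact_gt0 ?muln_gt0 ?fact_gt0 // IHn.
have -> : (2 * n).+2 = 2 * n.+1 by lia.
rewrite lognM // logn_prime // (@lognE 2 (2 * n).+1).
by rewrite dvdn2 /= oddM /=; lia.
Qed.

(** By Kummer's theorem this is the number of carries in [n + n] in base 2, which is the number of
    one bits of [n]. *)
Definition popcount (n : nat) : nat := logn 2 'C(2 * n, n).

(** Legendre's formula at the prime 2, obtained from [(2n)! = 'C(2n, n) * n! * n!]. *)
Lemma popcount_logn_fact n : popcount n + logn 2 n`! = n.
Proof.
have le_n : n <= 2 * n by lia.
have := congr1 (logn 2) (bin_fact le_n).
have -> : 2 * n - n = n by lia.
rewrite logn2_fact_double !lognM ?muln_gt0 ?fact_gt0 ?bin_gt0 // /popcount; lia.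
Qed.

Lemma popcount0 : popcount 0 = 0. Proof. by []. Qed.

(** Together with [popcount0], this recursion identifies the valuation with the count of one
    bits. *)
Lemma popcount_bit (r : bool) n : popcount (2 * n + r) = popcount n + r.
Proof.
have := popcount_logn_fact (2 * n + r); have := popcount_logn_fact n.
case: r; rewrite ?addn0 ?addn1; last by rewrite logn2_fact_double; lia.
rewrite factS lognM ?fact_gt0 // logn2_fact_double (@lognE 2 (2 * n).+1).
by rewrite dvdn2 /= oddM /=; lia.
Qed.

Lemma popcount_cat w a b :
  a < 2 ^ w -> popcount (a + b * 2 ^ w) = popcount a + popcount b.
Proof.
elim: w a => [|w IHw] a; first by case: a => // _; rewrite muln1.
rewrite expnS => lt_a; rewrite (divn_eq a 2) modn2 (mulnC _ 2).
have -> : 2 * (a %/ 2) + odd a + b * (2 * 2 ^ w)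
        = 2 * (a %/ 2 + b * 2 ^ w) + odd a by ring.
by rewrite !popcount_bit IHw; lia.
Qed.

Lemma popcount_compl w a :
  a < 2 ^ w -> popcount a + popcount (2 ^ w - 1 - a) = w.
Proof.
elim: w a => [|w IHw] a; first by case: a.
rewrite expnS => lt_a; rewrite (divn_eq a 2) modn2 (mulnC _ 2).
have -> : 2 * 2 ^ w - 1 - (2 * (a %/ 2) + odd a)
        = 2 * (2 ^ w - 1 - a %/ 2) + ~~ odd a by lia.
have lt_a2 : a %/ 2 < 2 ^ w by lia.
rewrite !popcount_bit addnACA IHw //; case: (odd a); lia.
Qed.

(** For [z > 0] the binary form of the product is [z - 1] followed by the [w]-bit complement of
    [z - 1], so both halves together have [w] one bits. *)
Lemma popcount_zero_test w z :
  z <= 2 ^ w -> popcount ((2 ^ w - 1) * z) = w * (z != 0).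
Proof.
case: z => [|z] lt_z; first by rewrite muln0 popcount0 muln0.
have -> : (2 ^ w - 1) * z.+1 = (2 ^ w - 1 - z) + z * 2 ^ w by nia.
by rewrite popcount_cat 1?addnC ?popcount_compl ?muln1; lia.
Qed.

Lemma popcount_sum k N (d : nat -> nat) :
  (forall x, x < N -> d x < 2 ^ k) ->
  popcount (\sum_(x < N) d x * (2 ^ k) ^ x) = \sum_(x < N) popcount (d x).
Proof.
elim: N => [|N IHN] dk; first by rewrite !big_ord0.
rewrite !big_ord_recr /= -expnM popcount_cat ?IHN //.
  by move=> x lt_x; apply/dk/ltnW.
by rewrite expnM; apply: sum_digit_lt => x lt_x; apply/dk/ltnW.
Qed.

Lemma gcd_pow2 c k : 0 < c -> logn 2 c <= k -> gcdn c (2 ^ k) = 2 ^ logn 2 c.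
Proof.
move=> c_gt0 le_k; have [o co_o Ec] := pfactor_coprime (isT : prime 2) c_gt0.
rewrite {1}Ec -(subnK le_k) expnD -muln_gcdl.
by rewrite (eqP (coprimeXr _ _)) ?mul1n // coprime_sym.
Qed.

(** The exponent [2 * n] is large enough, as [popcount n <= n]. *)
Lemma gcd_central_binomial n : gcdn 'C(2 * n, n) (2 ^ (2 * n)) = 2 ^ popcount n.
Proof.
apply: gcd_pow2; first by rewrite bin_gt0; lia.
by have := popcount_logn_fact n; rewrite /popcount; lia.
Qed.

(* A block [M * Z x] has [w] one bits if [Z x != 0] and none otherwise; the count
   [c] is read off [(M + 1) ^ c = c * M + 1] modulo [M * M]. *)
Lemma popcount_zero_count N w (Z : nat -> nat) :
  (forall x, x < N -> Z x <= 2 ^ w) -> N + 2 < 2 ^ w ->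
  let M := 2 ^ w - 1 in
  (2 ^ popcount (\sum_(x < N) (M * Z x) * (2 ^ (2 * w)) ^ x) %% (M * M)) %/ M
  = \sum_(x < N) (Z x != 0).
Proof.
move=> leZ ltN M; have M_gt0 : 0 < M by rewrite /M; lia.
rewrite (@popcount_sum (2 * w) N (fun x => M * Z x)); last first.
  move=> x /leZ le_w; rewrite mul2n -addnn expnD; move: le_w; rewrite /M; nia.
under eq_bigr => x _ do rewrite (popcount_zero_test (leZ x (ltn_ord x))).
rewrite -big_distrr /= expnM.
set c := \sum_(x < N) _; have lec : c <= N.
  by rewrite -[leqRHS]card_ord -sum1_card; apply: leq_sum => x _; case: (_ != _).
have EM : 2 ^ w = M + 1 by rewrite /M; lia.
rewrite EM in ltN *; move: (M) M_gt0 ltN {EM leZ} => {}M M_gt0 ltN; clearbody c.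
have [q ->] : exists q, (M + 1) ^ c = q * (M * M) + (c * M + 1).
  elim: (c) => [|d [q IHd]]; first by exists 0.
  by exists (q * M + q + d); rewrite expnS IHd; ring.
have ltcM : c < M by lia.
rewrite modnMDl modn_small; last by nia.
by rewrite divnMDl // divn_small ?addn0 //; lia.
Qed.

(** * Packed functions *)

Definition arith (k : nat) (f : k.-tuple nat -> nat) : Prop :=
  exists T : aterm k, aeval T =1 f.

Lemma eq_arith k (f g : k.-tuple nat -> nat) : f =1 g -> arith f -> arith g.
Proof. by move=> eq_fg [T ET]; exists T => v; rewrite ET. Qed.

Lemma arith_var k (i : 'I_k) : arith (fun v => tnth v i).
Proof. by exists (AVar i). Qed.

Lemma arith_const k c : arith (fun _ : k.-tuple nat => c).
Proof. by exists (AConst k c). Qed.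

Lemma arith_add k (f g : k.-tuple nat -> nat) :
  arith f -> arith g -> arith (fun v => f v + g v).
Proof. by move=> [S ES] [T ET]; exists (AAdd S T) => v /=; rewrite ES ET. Qed.

Lemma arith_sub k (f g : k.-tuple nat -> nat) :
  arith f -> arith g -> arith (fun v => f v - g v).
Proof. by move=> [S ES] [T ET]; exists (ASub S T) => v /=; rewrite ES ET. Qed.

Lemma arith_mul k (f g : k.-tuple nat -> nat) :
  arith f -> arith g -> arith (fun v => f v * g v).
Proof. by move=> [S ES] [T ET]; exists (AMul S T) => v /=; rewrite ES ET. Qed.

Lemma arith_div k (f g : k.-tuple nat -> nat) :
  arith f -> arith g -> arith (fun v => f v %/ g v).
Proof. by move=> [S ES] [T ET]; exists (ADiv S T) => v /=; rewrite ES ET. Qed.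

Lemma arith_mod k (f g : k.-tuple nat -> nat) :
  arith f -> arith g -> arith (fun v => f v %% g v).
Proof. by move=> [S ES] [T ET]; exists (AMod S T) => v /=; rewrite ES ET. Qed.

Lemma arith_exp k (f g : k.-tuple nat -> nat) :
  arith f -> arith g -> arith (fun v => f v ^ g v).
Proof. by move=> [S ES] [T ET]; exists (AExp S T) => v /=; rewrite ES ET. Qed.

Lemma arith_eq0 k (f : k.-tuple nat -> nat) :
  arith f -> arith (fun v => (f v == 0) : nat).
Proof.
move=> fA; apply: (@eq_arith _ (fun v => 1 - f v)) => [v|]; first by case: (f v).
by apply: arith_sub => //; exact: arith_const.
Qed.

Lemma arith_S k (f : k.-tuple nat -> nat) : arith f -> arith (fun v => (f v).+1).
Proof.
move=> fA; apply: (@eq_arith _ (fun v => f v + 1)) => [v|]; first by rewrite addn1.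
by apply: arith_add => //; exact: arith_const.
Qed.

Ltac arith_tac := repeat first
  [ eassumption | exact: arith_const | exact: arith_var
  | apply: arith_S | apply: arith_add | apply: arith_sub | apply: arith_mul
  | apply: arith_div | apply: arith_mod | apply: arith_exp | apply: arith_eq0 ].

(* Arithmetic terms give the values at every arithmetic base [b] of the
   polynomial with coefficients [f v 0, ..., f v (N v - 1)]; the digits [f v x]
   need not be smaller than [b], and [b = 1] gives the plain sum. *)
Definition packable (k : nat) (N : k.-tuple nat -> nat)
    (f : k.-tuple nat -> nat -> nat) : Prop :=
  forall b, arith b -> arith (fun v => \sum_(x < N v) f v x * b v ^ x).

Lemma eq_packable k (N : k.-tuple nat -> nat) f g :
  (forall v x, x < N v -> f v x = g v x) -> packable N f -> packable N g.
Proof.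
move=> eq_fg fP b bA; apply: eq_arith (fP b bA) => v.
by apply: eq_bigr => x _; rewrite eq_fg.
Qed.

Lemma arith_sum_packable k (N : k.-tuple nat -> nat) f :
  packable N f -> arith (fun v => \sum_(x < N v) f v x).
Proof.
move=> fP; apply: eq_arith (fP _ (arith_const k 1)) => v.
by apply: eq_bigr => x _; rewrite exp1n muln1.
Qed.

Lemma leq_sum_term N (f : nat -> nat) x : x < N -> f x <= \sum_(y < N) f y.
Proof. by move=> lt_xN; rewrite (bigD1 (Ordinal lt_xN)) //= leq_addr. Qed.

(* It suffices to evaluate the generating polynomial at large bases [e]: its
   value at [b] is then the residue modulo [e - b]. *)
Lemma packable_large k (N b0 F : k.-tuple nat -> nat) f :
  arith N -> arith b0 -> arith F ->
  (forall v x, x < N v -> f v x <= F v) ->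
  (forall e, arith e -> (forall v, b0 v <= e v) ->
    arith (fun v => \sum_(x < N v) f v x * e v ^ x)) ->
  packable N f.
Proof.
move=> NA b0A FA lefF fP b bA.
(* [N v * F v * (b v + 1) ^ N v] bounds the value at [b], so the modulus [e v - b v] exceeds it;
   [b v + 1] keeps the powers monotone even for [b v = 0]. *)
pose e v := b v + b0 v + N v * F v * (b v + 1) ^ N v + 1.
have eA : arith e by rewrite /e; arith_tac.
have le_b0e v : b0 v <= e v by rewrite /e; lia.
apply: (@eq_arith _ (fun v => (\sum_(x < N v) f v x * e v ^ x) %% (e v - b v))).
  move=> v; apply: sum_mod_change_base; first by rewrite /e; lia.
  apply: (@leq_ltn_trans (N v * F v * (b v + 1) ^ N v)); last by rewrite /e; lia.
  rewrite -mulnA -[X in X * _]card_ord -sum_nat_const; apply: leq_sum => x _.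
  apply: leq_mul; first exact: lefF.
  apply: (@leq_trans ((b v + 1) ^ x)); last first.
    by rewrite leq_pexp2l ?addn1 // ltnW.
  by case: (nat_of_ord x) => // n; rewrite leq_exp2r //; lia.
by have := fP e eA le_b0e; move=> SA; arith_tac.
Qed.

Lemma packable1 k (N : k.-tuple nat -> nat) :
  arith N -> packable N (fun _ _ => 1).
Proof.
move=> NA; apply: (@packable_large _ _ (fun _ => 2) (fun _ => 1)) => //; try by arith_tac.
move=> e eA le2e; apply: (@eq_arith _ (fun v => (e v ^ N v - 1) %/ (e v - 1))).
  move=> v; have e1 := le2e v.
  rewrite -sum_geom // mulnK ?subn_gt0 //.
  by apply: eq_bigr => x _; rewrite mul1n.
by arith_tac.
Qed.

Lemma arith_geom k (N b : k.-tuple nat -> nat) :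
  arith N -> arith b -> arith (fun v => \sum_(x < N v) b v ^ x).
Proof.
move=> NA bA; apply: eq_arith (packable1 NA bA) => v.
by apply: eq_bigr => x _; rewrite mul1n.
Qed.

Lemma packable_exp k (N c : k.-tuple nat -> nat) :
  arith N -> arith c -> packable N (fun v x => c v ^ x).
Proof.
move=> NA cA b bA; apply: eq_arith (arith_geom NA (arith_mul cA bA)) => v.
by apply: eq_bigr => x _; rewrite expnMn.
Qed.

Lemma packable_const k (N c : k.-tuple nat -> nat) :
  arith N -> arith c -> packable N (fun v _ => c v).
Proof.
move=> NA cA b bA; apply: eq_arith (arith_mul cA (arith_geom NA bA)) => v.
by rewrite big_distrr.
Qed.

Lemma packable_id k (N : k.-tuple nat -> nat) :
  arith N -> packable N (fun _ x => x).
Proof.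
move=> NA; apply: (@packable_large _ _ (fun _ => 2) N) => //; try by arith_tac.
  by move=> v x /ltnW.
move=> e eA le2e.
apply: (@eq_arith _ (fun v =>
   (N v * e v ^ N v - e v * (\sum_(x < N v) e v ^ x)) %/ (e v - 1))).
  move=> v; have e1 := le2e v.
  by rewrite -sum_id_geom ?addnK ?mulnK ?subn_gt0 //; lia.
have := arith_geom NA eA => SA; arith_tac.
Qed.

Lemma packable_add k (N : k.-tuple nat -> nat) f g :
  packable N f -> packable N g -> packable N (fun v x => f v x + g v x).
Proof.
move=> fP gP b bA; apply: eq_arith (arith_add (fP b bA) (gP b bA)) => v.
by rewrite -big_split; apply: eq_bigr => x _; rewrite mulnDl.
Qed.

(** Packed sums may be subtracted as they stand only if no coefficient truncates; [packable_sub]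
    lifts this restriction. *)
Lemma packable_sub_le k (N : k.-tuple nat -> nat) f g :
  (forall v x, x < N v -> g v x <= f v x) ->
  packable N f -> packable N g -> packable N (fun v x => f v x - g v x).
Proof.
move=> le_gf fP gP b bA; apply: eq_arith (arith_sub (fP b bA) (gP b bA)) => v.
under [RHS]eq_bigr => x _ do rewrite mulnBl.
by rewrite sumnB // => x _; rewrite leq_mul2r le_gf ?orbT.
Qed.

(* The Hadamard product: as a polynomial in [e] modulo [e ^ N - 1], the product
   of the generating polynomials at [b * e] and [e ^ (N - 1)] collects the terms
   [x = y] in degree 0. *)
Lemma packable_mul k (N : k.-tuple nat -> nat) f g :
  arith N ->
  packable N f -> packable N g -> packable N (fun v x => f v x * g v x).
Proof.
move=> NA fP gP b bA.
pose S v := (\sum_(x < N v) f v x * b v ^ x) * (\sum_(y < N v) g v y).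
(* [S v] is the sum of all coefficients of the product, so base [e v] produces no carries and meets
   the bound for wrapping exponents. *)
pose e v := S v + 2.
have eA : arith e.
  have := fP b bA; have := arith_sum_packable gP => ? ?.
  by rewrite /e /S; arith_tac.
pose h v := ((\sum_(x < N v) f v x * (b v * e v) ^ x)
   * (\sum_(y < N v) g v y * (e v ^ (N v - 1)) ^ y)) %% (e v ^ N v - 1) %% e v.
apply: (@eq_arith _ h); last first.
  have e1A : arith (fun v => e v ^ (N v - 1)) by arith_tac.
  have := fP _ (arith_mul bA eA); have := gP _ e1A => ? ?.
  by rewrite /h; arith_tac.
move=> v; rewrite /h; case: (posnP (N v)) => [->|N_gt0].
  by rewrite !big_ord0 mul0n !mod0n.
have ES : S v = \sum_(p : 'I_(N v) * 'I_(N v)) f v p.1 * b v ^ p.1 * g v p.2.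
  rewrite -(pair_bigA _ (fun x y : 'I_(N v) => f v x * b v ^ x * g v y)) /=.
  by rewrite /S big_distrl; apply: eq_bigr => x _; rewrite big_distrr.
rewrite big_distrl /=; under eq_bigr => x _ do rewrite big_distrr /=.
rewrite pair_bigA /=.
rewrite (eq_bigr (fun p : 'I_(N v) * 'I_(N v) =>
  (f v p.1 * b v ^ p.1 * g v p.2) * e v ^ (p.1 + (N v - 1) * p.2))); last first.
  by move=> p _; rewrite expnMn -expnM expnD; ring.
rewrite sum_mod_predn_exp //; last by rewrite -ES /e; lia.
have := @coef_sum _ (index_enum _)
  (fun p : 'I_(N v) * 'I_(N v) => f v p.1 * b v ^ p.1 * g v p.2)
  (fun p => (p.1 + (N v - 1) * p.2) %% N v) (e v) 0.
rewrite divn1 -ES => -> //; last by rewrite /e; lia.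
rewrite -(pair_big_dep xpredT
  (fun x y : 'I_(N v) => (x + (N v - 1) * y) %% N v == 0)
  (fun x y : 'I_(N v) => f v x * b v ^ x * g v y)) /=.
apply: eq_bigr => x _; rewrite (big_pred1 x) => [|y]; first by rewrite mulnAC.
rewrite [RHS]/= -val_eqE /=; have := ltn_ord x; have := ltn_ord y.
move: (nat_of_ord x) (nat_of_ord y) => {}x {}y lt_yN lt_xN.
have [le_yx | lt_xy] := leqP y x.
  have -> : x + (N v - 1) * y = y * N v + (x - y) by nia.
  by rewrite modnMDl modn_small; lia.
have -> : x + (N v - 1) * y = y.-1 * N v + (N v + x - y) by nia.
by rewrite modnMDl modn_small; lia.
Qed.

(** * Counting the zeros of a packed function *)

Lemma arith_gcd k (a b : k.-tuple nat -> nat) :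
  (forall v, 0 < a v) -> (forall v, 0 < b v) ->
  arith a -> arith b -> arith (fun v => gcdn (a v) (b v)).
Proof.
move=> a_gt0 b_gt0 aA bA; pose e v := a v * b v + 1.
have eA : arith e by rewrite /e; arith_tac.
apply: (@eq_arith _ (fun v =>
  (\sum_(x < b v) (e v ^ a v) ^ x) * (e v ^ b v * \sum_(y < a v) (e v ^ b v) ^ y)
  %/ e v ^ (a v * b v) %% e v)) => [v|]; first by rewrite /e -gcd_coef.
have := arith_geom bA (arith_exp eA aA); have := arith_geom aA (arith_exp eA bA).
by move=> ? ?; arith_tac.
Qed.

(** The gcd yields the count only as an exponent of 2; [popcount_zero_count] is shaped to read it
    off from there. *)
Lemma arith_exp2_popcount k (f : k.-tuple nat -> nat) :
  arith f -> arith (fun v => 2 ^ popcount (f v)).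
Proof.
move=> fA.
apply: (@eq_arith _ (fun v => gcdn 'C(2 * f v, f v) (2 ^ (2 * f v)))) => [v|].
  exact: gcd_central_binomial.
apply: arith_gcd => [v|v||]; try by arith_tac.
- by rewrite bin_gt0; lia.
- by rewrite expn_gt0.
pose e v := 2 ^ (2 * f v) + 1.
apply: (@eq_arith _ (fun v => ((e v + 1) ^ (2 * f v)) %/ e v ^ f v %% e v)) => [v|].
  by rewrite central_binomial_coef.
by rewrite /e; arith_tac.
Qed.

Lemma arith_count_zeros k (N : k.-tuple nat -> nat) Z :
  arith N -> packable N Z -> arith (fun v => \sum_(x < N v) (Z v x == 0)).
Proof.
move=> NA ZP; have SA := arith_sum_packable ZP.
(* Makes [2 ^ w v] exceed each value [Z v x] as well as [N v + 2]. *)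
pose w v := (\sum_(x < N v) Z v x) + N v + 2.
have wA : arith w by rewrite /w; arith_tac.
pose M v := 2 ^ w v - 1.
have MA : arith M by rewrite /M; arith_tac.
have lt_w v : w v < 2 ^ w v by exact: ltn_expl.
pose h v := N v - (2 ^ popcount (\sum_(x < N v) (M v * Z v x) * (2 ^ (2 * w v)) ^ x)
                   %% (M v * M v)) %/ M v.
apply: (@eq_arith _ h) => [v|].
  rewrite /h popcount_zero_count => [|x lt_x|]; last 2 first.
  - apply/ltnW/leq_ltn_trans/lt_w; have := leq_sum_term (Z v) lt_x.
    by rewrite /w; lia.
  - by apply: leq_ltn_trans (lt_w v); rewrite /w; lia.
  rewrite -[X in X - _]card_ord -sum1_card.
  rewrite (eq_bigr (fun x : 'I__ => (Z v x == 0) + (Z v x != 0))).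
    by rewrite big_split addnK.
  by move=> x _; case: eqP.
have PP := packable_mul NA (packable_const NA MA) ZP.
have bA : arith (fun v => 2 ^ (2 * w v)) by arith_tac.
have := arith_exp2_popcount (PP _ bA) => ?.
by rewrite /h; arith_tac.
Qed.

(** * Packing over a product of two ranges *)

Lemma expn_mod_div b N z : b ^ z = b ^ (z %% N) * (b ^ N) ^ (z %/ N).
Proof. by rewrite -expnM -expnD addnC (mulnC N) -divn_eq. Qed.

(** As [b ^ z = b ^ (z %% N) * (b ^ N) ^ (z %/ N)], the packed sum factors into one for [f] and a
    geometric one. *)
Lemma packable_mod k (N K : k.-tuple nat -> nat) f :
  arith N -> arith K -> packable N f ->
  packable (fun v => N v * K v) (fun v z => f v (z %% N v)).
Proof.
move=> NA KA fP b bA.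
apply: (@eq_arith _ (fun v =>
  (\sum_(x < N v) f v x * b v ^ x) * (\sum_(y < K v) (b v ^ N v) ^ y))) => [v|].
  under [RHS]eq_bigr => z _ do rewrite (expn_mod_div _ (N v)) mulnA.
  rewrite (sum_mod_div _ _ (fun x y => f v x * b v ^ x * (b v ^ N v) ^ y)).
  by rewrite big_distrl; apply: eq_bigr => x _; rewrite big_distrr.
have := fP b bA; have := arith_geom KA (arith_exp bA NA) => ? ?.
by arith_tac.
Qed.

Lemma packable_div k (N K : k.-tuple nat -> nat) f :
  arith N -> arith K -> packable K f ->
  packable (fun v => N v * K v) (fun v z => f v (z %/ N v)).
Proof.
move=> NA KA fP b bA.
apply: (@eq_arith _ (fun v =>
  (\sum_(x < N v) b v ^ x) * (\sum_(y < K v) f v y * (b v ^ N v) ^ y))) => [v|].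
  under [RHS]eq_bigr => z _ do rewrite (expn_mod_div _ (N v)) mulnCA.
  rewrite (sum_mod_div _ _ (fun x y => b v ^ x * (f v y * (b v ^ N v) ^ y))).
  by rewrite big_distrl; apply: eq_bigr => x _; rewrite big_distrr.
have := fP _ (arith_exp bA NA); have := arith_geom NA bA => ? ?.
by arith_tac.
Qed.

(** The weight [b ^ x] depends on [z] only through [x = z %% N], so it can be moved into the summand
    and a plain sum over all [z] taken. *)
Lemma packable_sum k (N K : k.-tuple nat -> nat) g :
  arith N -> arith K ->
  packable (fun v => N v * K v) (fun v z => g v (z %% N v) (z %/ N v)) ->
  packable N (fun v x => \sum_(y < K v) g v x y).
Proof.
move=> NA KA gP b bA; have NKA := arith_mul NA KA.
have := arith_sum_packable (packable_mul NKA gP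
  (packable_mod NA KA (packable_exp NA bA))).
apply: eq_arith => v.
rewrite (sum_mod_div _ _ (fun x y => g v x y * b v ^ x)).
by apply: eq_bigr => x _; rewrite big_distrl.
Qed.

(** * Tests for zero and equality *)

(** The squared distance never truncates, since [2 * (p * q) <= p * p + q * q]; thus it tests
    equality with the restricted subtraction alone. *)
Lemma sqdist_eq0 (p q : nat) : (p * p + q * q - 2 * (p * q) == 0) = (p == q).
Proof.
wlog le_pq : p q / p <= q => [IH|].
  have [/IH //|/ltnW/IH Eqp] := leqP p q.
  by rewrite addnC (mulnC p) Eqp eq_sym.
rewrite -(subnKC le_pq); move: (q - p) => d.
have -> : p * p + (p + d) * (p + d) = d * d + 2 * (p * (p + d)) by ring.
by rewrite addnK muln_eq0 orbb -{1}[p]addn0 eqn_add2l eq_sym.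
Qed.

Lemma packable_sqdist k (N : k.-tuple nat -> nat) f g :
  arith N -> packable N f -> packable N g ->
  packable N (fun v x => f v x * f v x + g v x * g v x - 2 * (f v x * g v x)).
Proof.
move=> NA fP gP; apply: packable_sub_le => [v x _||]; first by rewrite !mulnn nat_Cauchy.
  by apply: packable_add; exact: packable_mul.
apply: packable_mul => //; last exact: packable_mul.
by apply: packable_const => //; exact: arith_const.
Qed.

Lemma sum_lt_const c K : c <= K -> \sum_(y < K) (y < c) = c.
Proof.
have -> : \sum_(y < K) (y < c) = minn c K; last by move/minn_idPl.
by elim: K => [|K IHK]; rewrite ?big_ord0 ?minn0 // big_ord_recr /= IHK; lia.
Qed.

Lemma sum_eq_const c K (g : nat -> nat) :
  c < K -> \sum_(y < K) (y == c :> nat) * g y = g c.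
Proof.
move=> lt_cK; rewrite (bigD1 (Ordinal lt_cK)) //= eqxx mul1n big1 ?addn0 // => y.
by rewrite -val_eqE /= => /negPf ->.
Qed.

(** Each [y < c] has the single partner [s = c - y - 1]. This makes [c] a count of solutions of an
    equation, which zero counting can handle before comparison is available. *)
Lemma sum_add_eq c K :
  c <= K -> \sum_(u < K * K) (u %% K + u %/ K + 1 == c) = c.
Proof.
move=> le_cK; rewrite (sum_mod_div _ _ (fun y s => y + s + 1 == c)).
rewrite -[RHS](sum_lt_const le_cK); apply: eq_bigr => y _.
have [lt_yc | le_cy] := ltnP y c; last first.
  by rewrite big1 // => s _; apply/eqP; rewrite eqb0; lia.
have lt_K : c - y - 1 < K by lia.
rewrite -[RHS](sum_eq_const (fun _ => 1) lt_K); apply: eq_bigr => s _.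
by rewrite muln1; congr nat_of_bool; apply/eqP/eqP; lia.
Qed.

(* The weight [b ^ x] of a zero [x] is obtained by counting it once for each of
   the [b ^ x] pairs [(y, s)] with [y + s + 1 = b ^ x]. *)
Lemma packable_eq0 k (N : k.-tuple nat -> nat) Z :
  arith N -> packable N Z -> packable N (fun v x => (Z v x == 0) : nat).
Proof.
(* [K v] bounds every weight [b v ^ x] with [x < N v]. *)
move=> NA ZP b bA; pose K v := (b v + 1) ^ N v.
have KA : arith K by rewrite /K; arith_tac.
have KKA := arith_mul KA KA.
pose p v u := u %% K v + u %/ K v + 1.
have pP : packable (fun v => K v * K v) p.
  apply: packable_add; last by apply: packable_const => //; exact: arith_const.
  apply: packable_add; first by apply: (packable_mod KA KA (packable_id KA)).
  by apply: (packable_div KA KA (packable_id KA)).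
have MA := arith_mul NA KKA.
have qP := packable_sqdist MA (packable_div NA KKA pP)
  (packable_mod NA KKA (packable_exp NA bA)).
(* A sum of naturals vanishes exactly when both parts do, so one count of zeros tests the
   conjunction of [Z v x = 0] and [p v u = b v ^ x]. *)
have := arith_count_zeros MA (packable_add (packable_mod NA KKA ZP) qP).
apply: eq_arith => v.
under eq_bigr => z _ do rewrite addn_eq0 sqdist_eq0.
rewrite (sum_mod_div _ _ (fun x u => (Z v x == 0) && (p v u == b v ^ x) : nat)).
apply: eq_bigr => x _; under eq_bigr => u _ do rewrite -mulnb.
rewrite -big_distrr /= sum_add_eq // /K.
apply: (@leq_trans ((b v + 1) ^ x)); last by rewrite leq_pexp2l ?addn1 // ltnW.
by case: (nat_of_ord x) => // n; rewrite leq_exp2r //; lia.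
Qed.

Lemma packable_eq k (N : k.-tuple nat -> nat) f g :
  arith N -> packable N f -> packable N g ->
  packable N (fun v x => (f v x == g v x) : nat).
Proof.
move=> NA fP gP; have := packable_eq0 NA (packable_sqdist NA fP gP).
by apply: eq_packable => v x _; rewrite sqdist_eq0.
Qed.

(** * Subtraction, order, division and exponentiation *)

(** [f - g] is the [s] with [s + g = f], selected by an equality test in a sum weighted by [s]; if
    [g] exceeds [f], no [s] qualifies and the sum is the truncated value 0. *)
Lemma packable_sub k (N : k.-tuple nat -> nat) f g :
  arith N -> packable N f -> packable N g ->
  packable N (fun v x => f v x - g v x).
Proof.
move=> NA fP gP; have SA := arith_sum_packable fP.
pose K v := (\sum_(x < N v) f v x) + 1.
have KA : arith K by rewrite /K; arith_tac.
have MA := arith_mul NA KA.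
have sP := packable_div NA KA (packable_id KA).
have fMP := packable_mod NA KA fP; have gMP := packable_mod NA KA gP.
have eqP := packable_mul MA (packable_eq MA (packable_add sP gMP) fMP) sP.
have := @packable_sum _ _ _ (fun v x s => (s + g v x == f v x) * s) NA KA eqP.
apply: eq_packable => v x lt_x; have := leq_sum_term (f v) lt_x => le_f.
have [le_gf | lt_fg] := leqP (g v x) (f v x); last first.
  rewrite big1 => [|s _]; first by lia.
  by have [Es | _] := eqVneq (s + g v x) (f v x); lia.
have lt_K : f v x - g v x < K v by rewrite /K; lia.
rewrite -[RHS](sum_eq_const (fun s => s) lt_K); apply: eq_bigr => s _.
by congr (nat_of_bool _ * _); apply/idP/idP; lia.
Qed.

Lemma packable_leq k (N : k.-tuple nat -> nat) f g :
  arith N -> packable N f -> packable N g ->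
  packable N (fun v x => (f v x <= g v x) : nat).
Proof. by move=> NA fP gP; exact: packable_eq0 (packable_sub NA fP gP). Qed.

(** The quotient counts the [q] with [(q + 1) * g <= f]; the factor [1 - (g == 0)] enforces quotient
    0 for divisor 0. *)
Lemma packable_divn k (N : k.-tuple nat -> nat) f g :
  arith N -> packable N f -> packable N g ->
  packable N (fun v x => f v x %/ g v x).
Proof.
move=> NA fP gP; have SA := arith_sum_packable fP.
pose K v := (\sum_(x < N v) f v x) + 1.
have KA : arith K by rewrite /K; arith_tac.
have MA := arith_mul NA KA.
have oneP := packable_const MA (arith_const k 1).
have qP := packable_add (packable_div NA KA (packable_id KA)) oneP.
have fMP := packable_mod NA KA fP; have gMP := packable_mod NA KA gP.
have leP := packable_mul MA (packable_leq MA (packable_mul MA qP gMP) fMP)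
  (packable_sub MA oneP (packable_eq0 MA gMP)).
have := @packable_sum _ _ _
  (fun v x q => ((q + 1) * g v x <= f v x) * (1 - (g v x == 0))) NA KA leP.
apply: eq_packable => v x lt_x; have := leq_sum_term (f v) lt_x => le_f.
have [-> | g_gt0] := posnP (g v x); first by rewrite divn0 big1 // => q _; rewrite muln0.
have le_K : f v x %/ g v x <= K v.
  by apply: leq_trans (leq_div _ _) _; rewrite /K; lia.
rewrite -[RHS](sum_lt_const le_K); apply: eq_bigr => q _.
by rewrite -leq_divRL // addn1 muln1.
Qed.

Lemma packable_modn k (N : k.-tuple nat -> nat) f g :
  arith N -> packable N f -> packable N g ->
  packable N (fun v x => f v x %% g v x).
Proof.
move=> NA fP gP.
have := packable_sub NA fP (packable_mul NA (packable_divn NA fP gP) gP).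
by apply: eq_packable => v x _; rewrite {1}(divn_eq (f v x) (g v x)) addKn.
Qed.

(** The sum over [j] of [(j == f) * 2 ^ j] needs only powers with the index as exponent, whose
    packing is geometric. *)
Lemma packable_exp2 k (N : k.-tuple nat -> nat) f :
  arith N -> packable N f -> packable N (fun v x => 2 ^ f v x).
Proof.
move=> NA fP; have SA := arith_sum_packable fP.
pose K v := (\sum_(x < N v) f v x) + 1.
have KA : arith K by rewrite /K; arith_tac.
have MA := arith_mul NA KA.
have jP := packable_div NA KA (packable_id KA).
have eP := packable_div NA KA (packable_exp KA (arith_const k 2)).
have P := packable_mul MA (packable_eq MA jP (packable_mod NA KA fP)) eP.
have := @packable_sum _ _ _ (fun v x j => (j == f v x) * 2 ^ j) NA KA P.
apply: eq_packable => v x lt_x; have := leq_sum_term (f v) lt_x => le_f.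
by rewrite sum_eq_const // /K; lia.
Qed.

(* [2 ^ u] is congruent to [x] modulo [2 ^ u - x]. *)
Lemma expn_via_exp2 x y :
  (2 ^ ((x * y + x + 1) * y)) %% (2 ^ (x * y + x + 1) - x) = x ^ y.
Proof.
have lt_x : x < 2 ^ x by exact: ltn_expl.
have le_xy : x ^ y <= 2 ^ (x * y).
  rewrite expnM; case: y => // y; rewrite leq_exp2r //; exact: ltnW.
have le2 : x ^ y < 2 ^ (x * y + x + 1) - x.
  rewrite !expnD expn1; have : 0 < 2 ^ (x * y) by rewrite expn_gt0.
  by move: (2 ^ x) (2 ^ _) (x ^ y) lt_x le_xy => X Y Z; nia.
rewrite -[RHS](modn_small le2) expnM -modnXm.
by rewrite -{1}[2 ^ (x * y + x + 1)](@subnK x) ?modnDl ?modnXm //; lia.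
Qed.

Lemma packable_expn k (N : k.-tuple nat -> nat) f g :
  arith N -> packable N f -> packable N g ->
  packable N (fun v x => f v x ^ g v x).
Proof.
move=> NA fP gP.
have uP := packable_add (packable_add (packable_mul NA fP gP) fP)
  (packable_const NA (arith_const k 1)).
have := packable_modn NA (packable_exp2 NA (packable_mul NA uP gP))
  (packable_sub NA (packable_exp2 NA uP) fP).
by apply: eq_packable => v x _; rewrite expn_via_exp2.
Qed.

(** * Closure of arithmetic terms under bounded sums *)

(** The packing index occupies variable 0; the other variables are constant along the packing, and
    every constructor preserves packability. *)
Lemma packable_aeval k (T : aterm k.+1) (N : k.-tuple nat -> nat) :
  arith N -> packable N (fun v x => aeval T [tuple of x :: v]).
Proof.
move=> NA; elim: T => [i|c|S IHS T IHT|S IHS T IHT|S IHS T IHT|S IHS T IHT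
  |S IHS T IHT|S IHS T IHT] /=.
- case: (unliftP ord0 i) => [j|] ->.
    apply: eq_packable (packable_const NA (arith_var j)) => v x _.
    by rewrite tnthS.
  by apply: eq_packable (packable_id NA) => v x _; rewrite tnth0.
- by apply: packable_const => //; exact: arith_const.
- exact: packable_add.
- exact: packable_sub.
- exact: packable_mul.
- exact: packable_divn.
- exact: packable_modn.
- exact: packable_expn.
Qed.

Theorem arith_sum k (N : k.-tuple nat -> nat) (f : k.+1.-tuple nat -> nat) :
  arith N -> arith f -> arith (fun v => \sum_(x < N v) f [tuple of val x :: v]).
Proof.
move=> NA [T ET]; apply: eq_arith (arith_sum_packable (packable_aeval T NA)) => v.
by apply: eq_bigr => x _; rewrite ET.
Qed.

(** * Bounded iteration *)

Lemma arith_comp k l (f : k.-tuple nat -> nat) (phi : l.-tuple nat -> k.-tuple nat) :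
  arith f -> (forall i, arith (fun u => tnth (phi u) i)) ->
  arith (fun u => f (phi u)).
Proof.
move=> [T ET] phiA; apply: (@eq_arith _ (fun u => aeval T (phi u))) => [u|].
  exact: ET.
by elim: T {f ET} => [i|c||||||] //= *; arith_tac.
Qed.

Lemma arith_behead k (f : k.-tuple nat -> nat) :
  arith f -> arith (fun w : k.+1.-tuple nat => f (behead_tuple w)).
Proof.
move=> fA; apply: arith_comp => // i.
by apply: eq_arith (arith_var (inord i.+1)) => w; rewrite tnth_behead.
Qed.

Lemma arith_thead k : arith (fun w : k.+1.-tuple nat => thead w).
Proof. exact: arith_var. Qed.

Lemma arith_cons k l (s : k.-tuple nat -> nat -> nat)
    (phi : l.-tuple nat -> k.-tuple nat) (y : l.-tuple nat -> nat) :
  arith (fun w : k.+1.-tuple nat => s (behead_tuple w) (thead w)) ->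
  (forall i, arith (fun u => tnth (phi u) i)) -> arith y ->
  arith (fun u => s (phi u) (y u)).
Proof.
move=> sA phiA yA.
have := @arith_comp _ l _ (fun u => [tuple of y u :: phi u]) sA.
move=> compA; apply: eq_arith (compA _) => [u|i].
  by rewrite theadE; congr s; apply: val_inj.
case: (unliftP ord0 i) => [j|] ->.
  by apply: eq_arith (phiA j) => u; rewrite tnthS.
by apply: eq_arith yA => u; rewrite tnth0.
Qed.

Lemma arith_bigsum k (N : k.-tuple nat -> nat) (F : k.-tuple nat -> nat -> nat) :
  arith N -> arith (fun w : k.+1.-tuple nat => F (behead_tuple w) (thead w)) ->
  arith (fun v => \sum_(x < N v) F v x).
Proof.
move=> NA FA; apply: eq_arith (arith_sum NA FA) => v; apply: eq_bigr => x _.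
by rewrite theadE; congr F; apply: val_inj.
Qed.

Lemma arith_eq k (f g : k.-tuple nat -> nat) :
  arith f -> arith g -> arith (fun v => (f v == g v) : nat).
Proof.
move=> fA gA; apply: (@eq_arith _ (fun v => (f v - g v) + (g v - f v) == 0)) => [v|].
  by rewrite addn_eq0 -!/(leq _ _) -eqn_leq.
by apply: arith_eq0; arith_tac.
Qed.

(** Gives the uniqueness of histories: a number below [D ^ k] is determined by its [k] digits. *)
Lemma digits_mod (D h k : nat) : 0 < D ->
  \sum_(i < k) (h %/ D ^ i %% D) * D ^ i = h %% D ^ k.
Proof.
move=> D_gt0; elim: k => [|k IHk]; first by rewrite big_ord0 modn1.
rewrite big_ord_recr /= IHk expnS; set X := D ^ k.
have X_gt0 : 0 < X by rewrite expn_gt0 D_gt0.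
have Eh : h = h %/ X %/ D * (D * X) + (h %% X + h %/ X %% D * X).
  by rewrite addnCA mulnA -mulnDl -divn_eq addnC -divn_eq.
rewrite [in RHS]Eh modnMDl (@modn_small (_ + _)) //.
have := ltn_pmod h X_gt0; have := ltn_pmod (h %/ X) D_gt0.
move: (h %% X) (h %/ X %% D) => p q lt_q lt_p.
have: q.+1 * X <= D * X by rewrite leq_mul2r lt_q orbT.
by rewrite mulSn; lia.
Qed.

(* The only nonzero summand is the one of the history of the iteration, whose
   digits in base [D] are [c, s c, ..., iter t s c]. *)
Definition history_sum (s : nat -> nat) (c t D : nat) : nat :=
  \sum_(h < D ^ t.+1)
    (h %% D == c) *
    (\sum_(i < t) (h %/ D ^ i.+1 %% D == s (h %/ D ^ i %% D)) == t) *
    (h %/ D ^ t %% D).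

Lemma sum_bool_full t (a : nat -> bool) :
  reflect (forall i, i < t -> a i) (\sum_(i < t) a i == t).
Proof.
apply: (iffP eqP) => [|aT].
  elim: t => // t IHt; rewrite big_ord_recr /= => Et.
  have le_t : \sum_(i < t) a i <= t.
    by rewrite -[leqRHS]card_ord -sum1_card; apply: leq_sum => i _; case: (a i).
  have at_ : a t.
    by case: (a t) Et => //; rewrite addn0 => Et; move: le_t; rewrite Et ltnn.
  move=> i; rewrite ltnS leq_eqVlt => /orP[/eqP -> //|].
  by apply: IHt; move: Et; rewrite at_ addn1 => -[].
rewrite -[RHS]card_ord -sum1_card; apply: eq_bigr => i _.
by rewrite aT.
Qed.

Lemma history_sum_iter (s : nat -> nat) (c t D : nat) :
  (forall i, i <= t -> iter i s c < D) -> history_sum s c t D = iter t s c.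
Proof.
move=> ltD; pose H := \sum_(i < t.+1) iter i s c * D ^ i.
have lt_H : H < D ^ t.+1 by apply: sum_digit_lt => i; rewrite ltnS; exact: ltD.
have digH i : i <= t -> H %/ D ^ i %% D = iter i s c.
  by move=> le_it; rewrite /H (@digit_sum _ _ (fun i => iter i s c)).
rewrite -(digH t) // -(sum_eq_const (fun h => h %/ D ^ t %% D) lt_H).
apply: eq_bigr => h _; congr (_ * _); rewrite mulnb; congr nat_of_bool.
pose ok h i := h %/ D ^ i.+1 %% D == s (h %/ D ^ i %% D).
apply/andP/eqP => [[/eqP h0 /(sum_bool_full _ (ok h)) hS] | ->].
  have digh i : i <= t -> h %/ D ^ i %% D = iter i s c.
    elim: i => [|i IHi] le_it; first by rewrite divn1.
    by rewrite (eqP (hS i le_it)) IHi //= ltnW.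
  (* [h] is below [D ^ t.+1] and its digits are the iterates, so it equals [H]. *)
  rewrite -(modn_small (ltn_ord h)) -digits_mod; last exact: leq_ltn_trans (ltD 0 _).
  apply: eq_bigr => i _.
  by rewrite digh // -ltnS.
split; first by have := digH 0 (leq0n t); rewrite divn1 => ->.
by apply/(sum_bool_full _ (ok H)) => i lt_it; rewrite /ok !digH // ltnW.
Qed.

Lemma arith_history_sum k (s : k.-tuple nat -> nat -> nat) (c t D : k.-tuple nat -> nat) :
  arith (fun w : k.+1.-tuple nat => s (behead_tuple w) (thead w)) ->
  arith c -> arith t -> arith D ->
  arith (fun v => history_sum (s v) (c v) (t v) (D v)).
Proof.
move=> sA cA tA DA.
apply: (@arith_bigsum _ (fun v => D v ^ (t v).+1) (fun v h => (h %% D v == c v) *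
  (\sum_(i < t v) (h %/ D v ^ i.+1 %% D v == s v (h %/ D v ^ i %% D v)) == t v) *
  (h %/ D v ^ t v %% D v))); first by arith_tac.
(* Each bounded sum prepends its index to the tuple, so outer terms are lifted once below [h] and
   twice below [i]. *)
have cA1 := arith_behead cA; have tA1 := arith_behead tA.
have DA1 := arith_behead DA; have DA2 := arith_behead DA1.
have xA := arith_thead k; have xA1 := arith_behead xA; have xA2 := arith_thead k.+1.
apply: arith_mul; last by arith_tac.
apply: arith_mul; apply: arith_eq => //; first by arith_tac.
apply: (@arith_bigsum _ _ (fun w i =>
  thead w %/ D (behead_tuple w) ^ i.+1 %% D (behead_tuple w)
  == s (behead_tuple w) (thead w %/ D (behead_tuple w) ^ i %% D (behead_tuple w)))) => //.
apply: arith_eq; first by arith_tac.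
have digA : arith (fun u : k.+2.-tuple nat => thead (behead_tuple u)
    %/ D (behead_tuple (behead_tuple u)) ^ thead u
    %% D (behead_tuple (behead_tuple u))) by arith_tac.
apply: (arith_cons sA _ digA) => i.
exact: arith_behead (arith_behead (arith_var i)).
Qed.

(** * Goto programs *)

Lemma tuple_code_sum b i j s u L1 L2 :
  tuple_code b i j s u L1 L2
  = \sum_(k < 6) nth 0 [:: i; j; s; u; L1; L2] k * b ^ k.
Proof. by rewrite !big_ord_recr big_ord0 /= add0n muln1 expn1. Qed.

Definition command_fields m n (e : command m n) : seq nat :=
  match e with
  | Copy i j s => [:: i.+1; j.+1; val s; 0; 0; 0]
  | Goto u L1 L2 => [:: 0; 0; 0; u.+1; L1.+1; L2.+1]
  | Stop => [:: 0; 0; 0; 0; 0; 0]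
  end.

Lemma command_code_sum m n b (e : command m n) :
  command_code b e = \sum_(k < 6) nth 0 (command_fields e) k * b ^ k.
Proof. by case: e => *; exact: tuple_code_sum. Qed.

(** The base exceeds register indices, labels and [s <= 2], the last because a copy command forces
    [n >= 2]. *)
Lemma command_fields_lt m n (e : command m n) k :
  0 < m -> nth 0 (command_fields e) k < n + m + 1.
Proof.
move=> m_gt0; have [lt_k | le_k] := ltnP k (size (command_fields e)); last first.
  by rewrite nth_default // addn1.
suff /(all_nthP 0)/(_ k lt_k) : all (fun d => d < n + m + 1) (command_fields e) by [].
case: e {k lt_k} => [i j s|u L1 L2|] /=; rewrite ?andbT.
- by have := ltn_ord i; have := ltn_ord j; have := ltn_ord s; lia.
- by have := ltn_ord u; have := ltn_ord L1; have := ltn_ord L2; lia.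
- by lia.
Qed.

(** Truth values select the case: [i != 0] is a copy, [i = 0] with [u = 0] a stop, the rest a goto.
    In a copy, [+ 1] advances the label, and the new register value is added before the old one is
    removed, so that the removal does not truncate. A goto clears the label [c %% B] and adds the
    new one. *)
Definition code_step (m n P B c : nat) : nat :=
  let b := n + m + 1 in
  let e := P %/ b ^ (6 * (c %% B)) %% b ^ 6 in
  let dg k := e %/ b ^ k %% b in
  let reg i := c %/ B ^ i %% B in
  let i := dg 0 in let j := dg 1 in let s := dg 2 in
  let u := dg 3 in let L1 := dg 4 in let L2 := dg 5 in
  (1 - (i == 0)) * (c + 1 + (reg j + s - 1) * B ^ i - reg i * B ^ i)
  + (i == 0) * ((u == 0) * c + (1 - (u == 0)) *
      (c - c %% B + ((reg u == 0) * L1 + (1 - (reg u == 0)) * L2))).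

Lemma command_code_lt m n (e : command m n) :
  0 < m -> command_code (n + m + 1) e < (n + m + 1) ^ 6.
Proof.
move=> m_gt0; rewrite command_code_sum; apply: sum_digit_lt => k _.
exact: command_fields_lt.
Qed.

Lemma command_code_digit m n (e : command m n) k : 0 < m -> k < 6 ->
  command_code (n + m + 1) e %/ (n + m + 1) ^ k %% (n + m + 1)
  = nth 0 (command_fields e) k.
Proof.
move=> m_gt0 lt_k; rewrite command_code_sum digit_sum // => i _.
exact: command_fields_lt.
Qed.

Lemma program_code_digit m n (p : program m n) L : 1 <= L <= m ->
  let b := n + m + 1 in
  program_code p %/ b ^ (6 * L) %% b ^ 6 = command_code b (line p L).
Proof.
case/andP => L_gt0 le_Lm b.
(* Line codes start at exponent 6, so digit 0 in base [b ^ 6] is 0. *)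
pose d k := if k is k'.+1 then command_code b (nth Stop p k') else 0.
have -> : program_code p = \sum_(k < m.+1) d k * (b ^ 6) ^ k.
  rewrite big_ord_recl /= mul0n add0n; apply: eq_bigr => k _.
  by rewrite -/b (tnth_nth Stop) -expnM.
rewrite expnM digit_sum //; first by case: L L_gt0 le_Lm.
by case=> [|k] lt_k /=; [rewrite expn_gt0 /b addn1 | apply: command_code_lt; lia].
Qed.

(** * Codes of configurations and their digits *)

Definition config_below n (B : nat) (c : config n) : Prop :=
  label c < B /\ forall i, tnth (regs c) i < B.

Lemma config_code_sum n B (c : config n) :
  config_code B c = \sum_(k < n.-1.+1) nth 0 (label c :: regs c) k * B ^ k.
Proof.
rewrite big_ord_recl muln1; congr (_ + _); apply: eq_bigr => k _.
by rewrite /= -tnth_nth.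
Qed.

Lemma config_below_nth n B (c : config n) k :
  config_below B c -> k < n.-1.+1 -> nth 0 (label c :: regs c) k < B.
Proof.
case=> lt_label lt_regs; case: k => [|k] lt_k //=.
by rewrite -(tnth_nth 0 (regs c) (Ordinal (lt_k : k < n.-1))).
Qed.

Lemma config_code_lt n B (c : config n) :
  config_below B c -> config_code B c < B ^ n.-1.+1.
Proof.
move=> c_B; rewrite config_code_sum.
by apply: (@sum_digit_lt _ _ (nth 0 (label c :: regs c))) => k; exact: config_below_nth.
Qed.

Lemma config_code_digit n B (c : config n) k :
  config_below B c -> k < n.-1.+1 ->
  config_code B c %/ B ^ k %% B = nth 0 (label c :: regs c) k.
Proof.
move=> c_B lt_k; rewrite config_code_sum.
by rewrite (@digit_sum _ _ (nth 0 (label c :: regs c))) // => i; exact: config_below_nth.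
Qed.

Lemma config_code_label n B (c : config n) :
  config_below B c -> config_code B c %% B = label c.
Proof.
by move=> c_B; rewrite -[config_code B c]divn1 -(expn0 B) config_code_digit.
Qed.

Lemma config_code_reg n B (c : config n) (i : 'I_n.-1) :
  config_below B c -> config_code B c %/ B ^ i.+1 %% B = tnth (regs c) i.
Proof. by move=> c_B; rewrite config_code_digit ?ltnS //= -tnth_nth. Qed.

Lemma code_step_correct m n B (p : program m n) (c : config n) :
  config_below B c -> 1 <= label c <= m ->
  code_step m n (program_code p) B (config_code B c) = config_code B (step p c).
Proof.
move=> c_B label_m; have m_gt0 : 0 < m by lia.
rewrite /code_step (config_code_label c_B) program_code_digit // /step.
rewrite !command_code_digit //.
case: (line p (label c)) => [i j s|u L1 L2|]; cbn [command_fields nth].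
- rewrite !(config_code_reg _ c_B) mul0n addn0 mul1n /config_code /=.
  rewrite (bigD1 i) //= [in RHS](bigD1 i) //= tnth_mktuple eqxx.
  rewrite [in RHS](eq_bigr (fun k : 'I_n.-1 => tnth (regs c) k * B ^ k.+1)).
    move: (\sum_(_ < _ | _) _) (_ * B ^ _) ((_ + _ - 1) * B ^ _) => S X Y; lia.
  by move=> k /negPf ne_ki; rewrite tnth_mktuple ne_ki.
- rewrite (config_code_reg _ c_B) mul0n !mul1n !add0n /config_code /=.
  by case: eqP => _; lia.
- by rewrite mul0n !mul1n addn0.
Qed.

Lemma leq_config_max n (c : config n) v : v \in label c :: regs c -> v <= config_max c.
Proof. by move=> c_v; exact: (@leq_bigmax_seq _ _ _ id). Qed.

Lemma step_regs_leq m n (p : program m n) (c : config n) M :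
  (forall i, tnth (regs c) i <= M) -> forall i, tnth (regs (step p c)) i <= M.+1.
Proof.
move=> leM i; rewrite /step; case: (line p (label c)) => [a j s|u L1 L2|] /=.
- rewrite tnth_mktuple; case: eqP => _; last exact: leqW.
  by have := leM j; have := ltn_ord s; lia.
- exact: leqW.
- exact: leqW.
Qed.

Lemma run_regs_leq m n (p : program m n) (c : config n) t i :
  tnth (regs (run p t c)) i <= config_max c + t.
Proof.
elim: t i => [|t IHt] i.
  by rewrite addn0 leq_config_max // inE mem_tnth orbT.
by rewrite addnS; exact: step_regs_leq.
Qed.

Lemma run_code m n (p : program m n) (x0 : (n.-1).-tuple nat) t T :
  let c := start_config x0 in
  let B := m + config_max c + T in
  labels_in_range p c -> t <= T ->
  iter t (code_step m n (program_code p) B) (config_code B c)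
    = config_code B (run p t c)
  /\ config_code B (run p t c) < B ^ n.-1.+1.
Proof.
move=> c B ranged; have m_gt0 : 0 < m by have := ranged 0; rewrite /=; lia.
have mx_gt0 : 0 < config_max c by apply: leq_config_max; rewrite inE.
(* Labels are at most [m < B] because the maximum is positive; registers are at most
   [config_max c + T < B] because [m] is positive. *)
have below i : i <= T -> config_below B (run p i c).
  move=> le_iT; split=> [|j]; first by have := ranged i; rewrite /B; lia.
  by have := run_regs_leq p c i j; rewrite /B; lia.
elim: t => [|t IHt] le_tT; first by split=> //; exact/config_code_lt/(below 0).
have [Et _] := IHt (ltnW le_tT); rewrite iterS Et; split.
  by rewrite code_step_correct //; exact/below/ltnW.
exact/config_code_lt/(below t.+1).
Qed.

(** * The simulator as an arithmetic term *)

(** The history base exceeds the code of every configuration with entries below [m + mx + t]: such a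
    code has one digit for the label and [n.-1] for the registers. *)
Definition simulator (m n P c0 mx t : nat) : nat :=
  history_sum (code_step m n P (m + mx + t)) c0 t ((m + mx + t) ^ n.-1.+1).

Lemma simulator_correct m n (p : program m n) (x0 : (n.-1).-tuple nat) t :
  let c := start_config x0 in
  let B := m + config_max c + t in
  labels_in_range p c ->
  simulator m n (program_code p) (config_code B c) (config_max c) t
  = config_code B (run p t c).
Proof.
move=> c B ranged; rewrite /simulator history_sum_iter.
  by have [] := run_code ranged (leqnn t).
by move=> i /(run_code ranged) [->].
Qed.

Lemma arith_pred k (f : k.-tuple nat -> nat) : arith f -> arith (fun v => (f v).-1).
Proof.
move=> fA; apply: (@eq_arith _ (fun v => f v - 1)) => [v|]; first by rewrite subn1.
by arith_tac.
Qed.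

Lemma arith_code_step k (m n P B c : k.-tuple nat -> nat) :
  arith m -> arith n -> arith P -> arith B -> arith c ->
  arith (fun v => code_step (m v) (n v) (P v) (B v) (c v)).
Proof.
move=> mA nA PA BA cA; pose b v := n v + m v + 1.
have bA : arith b by rewrite /b; arith_tac.
pose e v := P v %/ b v ^ (6 * (c v %% B v)) %% b v ^ 6.
have eA : arith e by rewrite /e; arith_tac.
have dgA i : arith (fun v => e v %/ b v ^ i %% b v) by arith_tac.
have regA i : arith (fun v => c v %/ B v ^ (e v %/ b v ^ i %% b v) %% B v).
  by have := dgA i => ?; arith_tac.
rewrite /code_step; cbv zeta; rewrite -!/(b _) -!/(e _).
have := dgA 0; have := dgA 2; have := dgA 3; have := dgA 4; have := dgA 5.
have := regA 0; have := regA 1; have := regA 3 => *.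
by arith_tac.
Qed.

Lemma arith_simulator k (m n P c0 mx t : k.-tuple nat -> nat) :
  arith m -> arith n -> arith P -> arith c0 -> arith mx -> arith t ->
  arith (fun v => simulator (m v) (n v) (P v) (c0 v) (mx v) (t v)).
Proof.
move=> mA nA PA cA mxA tA; have pA := arith_pred nA.
have BA : arith (fun v => m v + mx v + t v) by arith_tac.
apply: (@arith_history_sum _
  (fun v => code_step (m v) (n v) (P v) (m v + mx v + t v))); try by arith_tac.
apply: arith_code_step; [exact: (arith_behead mA) | exact: (arith_behead nA)
  | exact: (arith_behead PA) | exact: (arith_behead BA) | exact: arith_thead].
Qed.

Lemma arith_big k (I : Type) (r : seq I) (op : nat -> nat -> nat) (idx : nat)
    (F : I -> k.-tuple nat -> nat) :
  (forall f g, arith f -> arith g -> arith (fun v : k.-tuple nat => op (f v) (g v))) ->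
  (forall i, arith (F i)) ->
  arith (fun v => \big[op/idx]_(i <- r) F i v).
Proof.
move=> opA FA; elim: r => [|i r IHr].
  by apply: eq_arith (arith_const k idx) => v; rewrite big_nil.
by apply: eq_arith (opA _ _ (FA i) IHr) => v; rewrite big_cons.
Qed.

Lemma arith_max k (f g : k.-tuple nat -> nat) :
  arith f -> arith g -> arith (fun v => maxn (f v) (g v)).
Proof.
move=> fA gA; apply: (@eq_arith _ (fun v => f v + (g v - f v))) => [v|].
  by rewrite maxnE.
by arith_tac.
Qed.

Lemma stopped_run m n (p : program m n) (c : config n) t T :
  stopped p (run p t c) -> t <= T -> run p T c = run p t c.
Proof.
move=> stop_t /subnK <-; rewrite /run iterD; elim: (T - t) => //= d ->.
move: stop_t; rewrite /stopped /step /run.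
by case: (line p _).
Qed.

Lemma input_config_max n r (x : r.-tuple nat) : r <= n.-1 ->
  config_max (input_config n x) = \max_(v <- 1 :: x) v.
Proof.
move=> le_r; apply/eqP; rewrite eqn_leq; apply/andP; split.
  apply/bigmax_leqP_seq => v; rewrite inE => /orP[/eqP -> _|/tnthP[i ->] _].
    by rewrite (@leq_bigmax_seq _ _ xpredT id) // inE.
  rewrite tnth_mktuple; have [lt_i | le_i] := ltnP i (size x); last by rewrite nth_default.
  by rewrite (@leq_bigmax_seq _ _ xpredT id) // inE mem_nth ?orbT.
apply/bigmax_leqP_seq => v; rewrite inE => /orP[/eqP -> _|/tnthP[i ->] _].
  by apply: leq_config_max; rewrite inE.
have lt_i : i < n.-1 by apply: leq_trans le_r.
apply: leq_config_max; rewrite inE; apply/orP; right; apply/tnthP.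
by exists (Ordinal lt_i); rewrite tnth_mktuple (tnth_nth 0).
Qed.

Lemma input_config_code n r B (x : r.-tuple nat) : r <= n.-1 ->
  config_code B (input_config n x) = 1 + \sum_(i < r) tnth x i * B ^ i.+1.
Proof.
move=> le_r; congr (_ + _).
rewrite (eq_bigr (fun i : 'I_r => nth 0 x i * B ^ i.+1)); last first.
  by move=> i _; rewrite (tnth_nth 0).
rewrite (big_ord_widen _ (fun i => nth 0 x i * B ^ i.+1) le_r) [RHS]big_mkcond.
apply: eq_bigr => i _; rewrite tnth_mktuple; case: ltnP => // le_i.
by rewrite nth_default ?size_tuple.
Qed.

Theorem mainTheorem10 :
  exists C : aterm 6,
    (forall (m n : nat) (p : program m n) (x0 : (n.-1).-tuple nat) (t : nat),
       1 <= n ->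
       labels_in_range p (start_config x0) ->
       let mx := config_max (start_config x0) in
       let B := m + mx + t in
       let c0 := config_code B (start_config x0) in
       aeval C [tuple m; n; program_code p; c0; mx; t]
       = config_code B (run p t (start_config x0)))
    /\
    (forall (m n r : nat) (p : program m n) (f : r.-tuple nat -> nat)
            (theta : aterm r),
       1 <= r <= n.-1 ->
       computes p f ->
       (forall (x : r.-tuple nat) (t : nat),
          computation_time p (input_config n x) t -> t <= aeval theta x) ->
       exists F : aterm r,
         forall x : r.-tuple nat,
           let th := aeval theta x in
           let mu := \max_(v <- 1 :: x) v in
           let B := m + mu + th in
           let c0 := 1 + \sum_(i < r) tnth x i * B ^ i.+1 in
           f x = aeval F x /\
           aeval F x
           = (aeval C [tuple m; n; program_code p; c0; mu; th] %% B ^ 2) %/ B).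
Proof.
pose var (i : nat) (v : 6.-tuple nat) := nth 0 v i.
have varA i : i < 6 -> arith (var i).
  move=> lt_i; apply: eq_arith (arith_var (Ordinal lt_i)) => v.
  by rewrite (tnth_nth 0).
have [C EC] : arith (fun v => simulator (var 0 v) (var 1 v) (var 2 v) (var 3 v)
    (var 4 v) (var 5 v)) by apply: arith_simulator; exact: varA.
exists C; split=> [m n p x0 t _ ranged mx B c0 | m n r p f theta].
  by rewrite EC /var /= simulator_correct.
case/andP=> r_gt0 le_r f_p theta_p.
have xA (i : 'I_r) : arith (fun x : r.-tuple nat => tnth x i) by exact: arith_var.
have thA : arith (aeval theta) by exists theta.
pose mu (x : r.-tuple nat) := \max_(v <- 1 :: x) v.
have muA : arith mu.
  apply: (@eq_arith _ (fun x => maxn 1 (\max_(i < r) tnth x i))) => [x|].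
    by rewrite /mu big_cons big_tuple.
  by apply: arith_max; [arith_tac | apply: arith_big => //; exact: arith_max].
pose B x := m + mu x + aeval theta x.
have BA : arith B by rewrite /B; arith_tac.
pose c0 x := 1 + \sum_(i < r) tnth x i * B x ^ i.+1.
have c0A : arith c0.
  apply: arith_add; first by arith_tac.
  by apply: arith_big => [|i]; [exact: arith_add | arith_tac].
pose sim x := simulator m n (program_code p) (c0 x) (mu x) (aeval theta x).
have simA : arith sim by apply: arith_simulator => //; exact: arith_const.
(* The right-hand side of the formula is itself arithmetic in [x], so it serves as [F]. *)
have [F EF] : arith (fun x => sim x %% B x ^ 2 %/ B x) by arith_tac.
exists F => x th mu0 B0 c1; rewrite EF EC; split=> //.
have [ranged [t [stop_t Et]]] := f_p x.
(* The bound [theta] concerns the first stopping time, so the minimal one is taken. *)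
have [t0 stop_t0 min_t0] := ex_minnP (ex_intro (fun t => stopped p (run p t _)) t stop_t).
have le_t0 : t0 <= aeval theta x.
  apply: theta_p; split=> // t' lt_t'; apply: contraL lt_t' => /min_t0.
  by rewrite -leqNgt.
(* The configuration no longer changes after [t0], so those at times [t] and [aeval theta x]
   agree. *)
rewrite -Et (stopped_run stop_t0 (min_t0 _ stop_t)) -(stopped_run stop_t0 le_t0).
have Emu := input_config_max x le_r.
have Esim := simulator_correct (aeval theta x) ranged.
move: Esim; cbv zeta; rewrite -/(input_config n x) Emu -/(mu x) -/(B x).
(* Reducing modulo [B x ^ 2] and then dividing by [B x] reads digit 1, the first register. *)
rewrite input_config_code // -/(c0 x) => Esim; rewrite /sim Esim -modn_divl.
have n_gt1 : 0 < n.-1 by lia.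
rewrite -[X in _ %/ X]expn1 (@config_code_reg _ _ _ (Ordinal n_gt1)).
  by rewrite (tnth_nth 0).
split=> [|i].
  have := ranged (aeval theta x); have : 0 < mu x by rewrite /mu big_cons; lia.
  by rewrite /B; lia.
have := run_regs_leq p (input_config n x) (aeval theta x) i.
by have := ranged 0; rewrite Emu -/(mu x) /B /=; lia.
Qed.
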